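(* Let $-\infty<a<b<+\infty$. For any càdlàg function $f:[a;b]\to\mathbb{R}$ the functions $$(0;\infty)\ni c\mapsto UTV^c(f,[a;b])\in[0;+\infty),\quad (0;\infty)\ni c\mapsto DTV^c(f,[a;b])\in[0;+\infty),\quad (0;\infty)\ni c\mapsto TV^c(f,[a;b])\in[0;+\infty)$$ are (finite-valued) nonincreasing, continuous, convex functions of the parameter $c$. Moreover, $\lim_{c\downarrow0}TV^c(f,[a;b])=TV(f,[a;b])$ (possibly $+\infty$), and for any $c\ge\|f\|_{osc}$ (with $c>0$), $TV^c(f,[a;b])=0$.
   Context: $\|f\|_{osc}=\sup_{s,u\in[a;b]}|f(s)-f(u)|$. With suprema over $n\ge1$ and $a\le t_0<\dots<t_n\le b$: $TV(f,[a;b])=\sup\sum_{i=1}^n|f(t_i)-f(t_{i-1})|$, $TV^c(f,[a;b])=\sup\sum_{i=1}^n\max\{|f(t_i)-f(t_{i-1})|-c,0\}$, $UTV^c(f,[a;b])=\sup\sum_{i=1}^n\max\{f(t_i)-f(t_{i-1})-c,0\}$, $DTV^c(f,[a;b])=\sup\sum_{i=1}^n\max\{f(t_{i-1})-f(t_i)-c,0\}$. *)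

(* Defs.v *)
From mathcomp Require Import all_boot all_order all_algebra.
From mathcomp Require Import all_classical all_reals all_analysis.
Set Implicit Arguments.
Unset Strict Implicit.
Unset Printing Implicit Defensive.
Import Order.TTheory GRing.Theory Num.Theory.
Import numFieldNormedType.Exports.
Local Open Scope classical_set_scope.
Local Open Scope ring_scope.

(* A function on [a; b] is represented by a total function f : R -> R; every
   notion below depends only on the restriction of f to [a; b]. *)

Definition cadlag (R : realType) (a b : R) (f : R -> R) : Prop :=
  (forall t, a <= t < b -> f x @[x --> t^'+] --> f t) /\
  (forall t, a < t <= b -> exists l : R, f x @[x --> t^'-] --> l).

Definition osc (R : realType) (a b : R) (f : R -> R) : \bar R :=
  ereal_sup [set `|f s - f u|%:E | s in `[a, b] & u in `[a, b]].

(* The sequences [:: t_0; ...; t_n] with n >= 1 and a <= t_0 < ... < t_n <= b.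
   In contrast with itv_partition, t_0 = a and t_n = b are not required. *)
Definition time_seqs (R : realType) (a b : R) : set (seq R) :=
  [set t | [/\ (1 < size t)%N, sorted <%R t & {subset t <= `[a, b]}]].

Definition sup_increments (R : realType) (a b : R) (phi : R -> R -> R) :
    \bar R :=
  ereal_sup [set (\sum_(1 <= i < size t) phi t`_i.-1 t`_i)%:E
            | t in time_seqs a b].

Definition TV (R : realType) (a b : R) (f : R -> R) : \bar R :=
  sup_increments a b (fun s t => `|f t - f s|).

Definition TVc (R : realType) (a b : R) (f : R -> R) (c : R) : \bar R :=
  sup_increments a b (fun s t => Num.max (`|f t - f s| - c) 0).

Definition UTVc (R : realType) (a b : R) (f : R -> R) (c : R) : \bar R :=
  sup_increments a b (fun s t => Num.max (f t - f s - c) 0).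

Definition DTVc (R : realType) (a b : R) (f : R -> R) (c : R) : \bar R :=
  sup_increments a b (fun s t => Num.max (f s - f t - c) 0).

(* `fine` loses nothing: the first conjunct makes F finite on ]0, +oo[. *)
Definition nonincr_cont_convex (R : realType) (F : R -> \bar R) : Prop :=
  [/\ forall c, 0 < c -> F c \is a fin_num /\ (0 <= F c)%E,
      {in `]0, +oo[ &, nonincreasing_fun (fun c => fine (F c))},
      {within `]0, +oo[, continuous (fun c => fine (F c))} &
      convex_function (`]0, +oo[%classic : set R^o) (fun c => fine (F c))].

Lemma TV_total_variation (R : realType) (a b : R) (f : R -> R) :
  a < b -> TV a b f = total_variation a b f.
Proof.
move=> ab; apply/eqP; rewrite eq_le; apply/andP; split.
  apply: ge_ereal_sup => _ [[|x [|y s]] [//= _ xys tab] <-].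
  have ax : a <= x by have /tab := mem_head x (y :: s); rewrite in_itv => /andP[].
  set z := last y s.
  have zb : z <= b.
    have /tab : z \in x :: y :: s by rewrite inE mem_last orbT.
    by rewrite in_itv => /andP[].
  have part : itv_partition x z (y :: s) by split; [exact: xys|exact: eqxx].
  have xz : x <= z by exact: itv_partition_le part.
  have -> : \sum_(1 <= i < (size s).+2)
      `|f (x :: y :: s)`_i - f (x :: y :: s)`_i.-1| = variation x z f (y :: s).
    rewrite /variation big_add1 [RHS]big_nat [LHS]big_nat.
    apply: eq_bigr => i /andP[_ ilt].
    by rewrite /comp (set_nth_default z) //= ?(set_nth_default z) //= ltnW.
  have le1 : ((variation x z f (y :: s))%:E <= total_variation x z f)%E.
    apply: ereal_sup_ubound; exists (variation x z f (y :: s)) => //.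
    exact: variations_variation.
  apply: (le_trans le1).
  rewrite (total_variationD f ax (le_trans xz zb)) (total_variationD f xz zb).
  rewrite (le_trans _ (leeDr _ (total_variation_ge0 f ax)))//.
  by rewrite leeDl// total_variation_ge0.
apply: ge_ereal_sup => _ [_ [s abs <-] <-].
apply: ereal_sup_ubound; exists (a :: s).
  have [sa /eqP sb] := abs; split => //=.
    by case: s sb {abs sa} => //= ab0; move: ab; rewrite ab0 ltxx.
  move=> x; rewrite inE => /predU1P[->|xs]; first by rewrite in_itv/= lexx ltW.
  have alls := order_path_min lt_trans sa.
  rewrite in_itv/= ltW ?(allP alls)//=.
  have srt : sorted <=%R s.
    by apply: sub_sorted (path_sorted sa) => u v /ltW.
  case: (splitPr xs) srt sb => s1 s2; rewrite last_cat/= => srt <-.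
  have /= := subseq_sorted le_trans (suffix_subseq s1 (x :: s2)) srt.
  move=> /(order_path_min le_trans) /allP h.
  by have := mem_last x s2; rewrite inE => /predU1P[->|/h].
rewrite /variation /= big_add1 big_nat [in RHS]big_nat; congr (_%:E).
apply: eq_bigr => i /andP[_ ilt].
by rewrite /comp (set_nth_default b) //= ?(set_nth_default b) //= ltnW.
Qed.

(* Main.v *)
Require Import Defs.
From mathcomp Require Import all_boot all_order all_algebra.
From mathcomp Require Import all_classical all_reals all_analysis.
From mathcomp Require Import ring lra.
Import Order.TTheory GRing.Theory Num.Theory.
Import numFieldNormedType.Exports.
Local Open Scope classical_set_scope.
Local Open Scope ring_scope.

(** Each of the three variations is, as a function of [c], the supremum over the
    time sequences of finite sums of [max (g s u - c) 0], where [g s u] is the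
    increment of [f] from [s] to [u], its opposite, or its absolute value.
    Every such term is nonnegative, nonincreasing and convex in [c], and these
    properties pass to sums and to suprema.  Once the suprema are finite,
    continuity on the open half-line comes for free, since a nonnegative
    nonincreasing convex function is locally Lipschitz there
    ([convex_nonincr_lipschitz]).

    Finiteness is where the càdlàg hypothesis enters.  One-sided limits allow
    [a, b] to be cut into finitely many pieces on whose interiors [f]
    oscillates by at most [c], so only steps that meet a cut point contribute
    to a sum.  This is recorded by a function [H], constant plus a jump at each
    cut point, such that [max (|f u - f s| - c) 0 <= H u - H s] for [s < u]
    ([cadlag_controlled]); summing along a time sequence telescopes to the bound
    [H b - H a], which does not depend on the sequence.

    As [c] decreases to 0 the monotone limit of [TVc] is its supremum, and
    suprema over [c] and over sequences commute ([TVc_cvg]): a sequence with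
    [n] times loses at most [n * c] when its increments are reduced by [c].
    If [c] dominates the oscillation, every term vanishes ([TVc_osc]). *)

(** * Sums over time sequences *)

Section sums_of_increments.
Context {R : realType}.
Implicit Types (a b c : R) (phi psi g : R -> R -> R) (H : R -> R) (t : seq R).

Definition sum_increments phi t : R := \sum_(1 <= i < size t) phi t`_i.-1 t`_i.

Definition excess g c (s u : R) : R := Num.max (g s u - c) 0.

Lemma excess_ge0 g c s u : 0 <= excess g c s u.
Proof. by rewrite /excess le_max lexx orbT. Qed.

Lemma le_excess g c d s u : c <= d -> excess g d s u <= excess g c s u.
Proof. by move=> cd; rewrite /excess ge_max !le_max lexx orbT andbT lerB. Qed.

Lemma excess_convex g c d l s u : 0 <= l <= 1 ->
  excess g (l * c + (1 - l) * d) s u <=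
  l * excess g c s u + (1 - l) * excess g d s u.
Proof.
move=> /andP[l0 l1]; rewrite {1}/excess ge_max; apply/andP; split.
  have -> : g s u - (l * c + (1 - l) * d) =
            l * (g s u - c) + (1 - l) * (g s u - d) by ring.
  by rewrite lerD ?ler_wpM2l ?subr_ge0// /excess le_max lexx.
by rewrite addr_ge0 ?mulr_ge0 ?subr_ge0 ?excess_ge0.
Qed.

Lemma time_seqs_step {a b t} i : time_seqs a b t -> (1 <= i < size t)%N ->
  [/\ a <= t`_i.-1, t`_i.-1 < t`_i & t`_i <= b].
Proof.
move=> [_ t_sorted t_ab]; case: i => // i /= it.
have /t_ab : t`_i \in t by rewrite mem_nth// ltnW.
have /t_ab : t`_i.+1 \in t by rewrite mem_nth.
rewrite !in_itv/= => /andP[_ ->] /andP[-> _]; split=> //.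
by apply: (sorted_ltn_nth lt_trans) => //; rewrite inE// ltnW.
Qed.

Lemma ler_sum_increments a b phi psi t : time_seqs a b t ->
  (forall s u, a <= s -> s < u -> u <= b -> phi s u <= psi s u) ->
  sum_increments phi t <= sum_increments psi t.
Proof.
move=> tab le_phi; rewrite /sum_increments big_nat [leRHS]big_nat.
by apply: ler_sum => i /(time_seqs_step _ tab)[? ? ?]; exact: le_phi.
Qed.

Lemma time_seqs_nonempty a b : a < b -> time_seqs a b [:: a; b].
Proof.
move=> ab; split=> //=; first by rewrite ab.
by move=> x; rewrite in_itv/= !inE => /orP[] /eqP->; rewrite lexx ltW.
Qed.

Lemma sum_increments_telescope a b H t : time_seqs a b t ->
  (forall s u, a <= s -> s <= u -> u <= b -> H s <= H u) ->
  sum_increments (fun s u => H u - H s) t <= H b - H a.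
Proof.
move=> tab ndH; have [t_size _ t_mem] := tab.
rewrite /sum_increments big_add1 /= (telescope_sumr (fun i => H t`_i)); last first.
  by case: t {tab t_mem} t_size.
have /t_mem : t`_(size t).-1 \in t by rewrite mem_nth// prednK// ltnW.
have /t_mem : t`_0 \in t by rewrite mem_nth// ltnW.
by rewrite !in_itv/= => /andP[? ?] /andP[? ?]; rewrite lerB ?ndH.
Qed.

End sums_of_increments.

(** * Nonnegative nonincreasing convex functions on the half-line *)

Section convex_nonincreasing.
Context {R : realType} (G : R -> R).
Hypothesis G_ge0 : forall x, 0 < x -> 0 <= G x.
Hypothesis G_ni : forall x y, 0 < x -> x <= y -> G y <= G x.
Hypothesis G_conv : forall x y l, 0 < x -> 0 < y -> 0 <= l <= 1 ->
  G (l * x + (1 - l) * y) <= l * G x + (1 - l) * G y.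

(** A chord of [G] to the right of [p + e] is no steeper than the chord from [p]
    to the right end, whose drop is at most [G p] and whose length is at
    least [e]. *)
Lemma convex_nonincr_lipschitz p e u v : 0 < p -> 0 < e ->
  p + e <= u -> p + e <= v -> `|G u - G v| <= G p / e * `|u - v|.
Proof.
move=> p0 e0; wlog uv : u v / u <= v => [wlg pu pv|pu _].
  by have [uv|/ltW vu] := leP u v; [|rewrite distrC (distrC u)]; exact: wlg.
have vp : 0 < v - p by lra.
rewrite ger0_norm ?subr_ge0 ?G_ni//; last lra.
rewrite ler0_norm ?subr_le0// opprB.
(* u is the barycentre of p and v with weight l at p. *)
set l := (v - u) / (v - p).
have l0 : 0 <= l by apply: divr_ge0; lra.
have l1 : l <= 1 by rewrite ler_pdivrMr// mul1r; lra.
have uE : u = l * p + (1 - l) * v by rewrite /l; field; rewrite gt_eqF.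
have Gu : G u - G v <= l * G p.
  have v0 : 0 < v by lra.
  have := G_conv p v l p0 v0; rewrite -uE l0 l1 => /(_ isT).
  have := mulr_ge0 l0 (G_ge0 _ v0); lra.
apply: (le_trans Gu).
have -> : G p / e * (v - u) = (v - u) / e * G p by ring.
by rewrite ler_wpM2r ?G_ge0// /l ler_wpM2l ?subr_ge0// lef_pV2 ?posrE//; lra.
Qed.

Lemma convex_nonincr_continuous : {within `]0, +oo[, continuous G}.
Proof.
rewrite continuous_open_subspace//.
move=> x; rewrite inE/= in_itv/= andbT => x0; apply/cvgrPdist_le => e e0.
(* A neighbourhood of x lies to the right of p + p = 2x/3. *)
set p := x / 3; have p0 : 0 < p by rewrite divr_gt0.
set K := G p / p; have K0 : 0 <= K by rewrite divr_ge0 ?G_ge0// ltW.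
(* K may be zero, hence the K + 1 in the modulus below. *)
near=> u.
have pu : p + p <= u by apply: ltW; near: u; apply: lt_nbhsr; rewrite /p; lra.
have ux : `|x - u| <= e / (K + 1).
  by near: u; apply: (cvgr_dist_le id x cvg_id); rewrite divr_gt0 // ltr_wpDl.
apply: le_trans (convex_nonincr_lipschitz p p _ _ p0 p0 _ pu) _.
  by rewrite /p; lra.
rewrite -/K (le_trans (ler_wpM2l K0 ux))// mulrCA ler_piMr ?(ltW e0)//.
by rewrite ler_pdivrMr; lra.
Unshelve. all: by end_near. Qed.

End convex_nonincreasing.

(** * Regularity in the parameter *)

Section excess_sup.
Context {R : realType}.
Implicit Types (a b c : R) (g : R -> R -> R) (H : R -> R).

(** The hypothesis gives finiteness: it forces [H] to be nondecreasing on the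
    interval from [a] to [b], so that every sum is at most [H b - H a].  Monotony
    and convexity are inherited from each single term, and continuity follows
    from them. *)
Lemma nonincr_cont_convex_excess_sup a b g : a < b ->
  (forall c, 0 < c -> exists H, forall s u, a <= s -> s < u -> u <= b ->
     excess g c s u <= H u - H s) ->
  nonincr_cont_convex (fun c => sup_increments a b (excess g c)).
Proof.
move=> ab gH; set F := fun c => sup_increments a b (excess g c).
have S_le c t : time_seqs a b t -> ((sum_increments (excess g c) t)%:E <= F c)%E.
  by move=> tab; apply: ereal_sup_ubound; exists t.
have F_le c M : (forall t, time_seqs a b t -> sum_increments (excess g c) t <= M) ->
    (F c <= M%:E)%E.
  by move=> leM; apply: ge_ereal_sup => _ [t tab <-]; rewrite lee_fin leM.
have F_ge0 c : (0 <= F c)%E.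
  apply: le_trans (S_le c _ (time_seqs_nonempty _ _ ab)).
  by rewrite lee_fin sumr_ge0// => i _; exact: excess_ge0.
have F_fin c : 0 < c -> F c \is a fin_num.
  move=> /gH[H leH]; rewrite ge0_fin_numE//.
  apply: (@le_lt_trans _ _ (H b - H a)%:E); last exact: ltry.
  apply: F_le => t tab; apply: le_trans (ler_sum_increments _ _ _ _ _ tab leH) _.
  apply: sum_increments_telescope tab _ => s u sa.
  rewrite le_eqVlt => /predU1P[->//|su ub]; rewrite -subr_ge0.
  exact: le_trans (excess_ge0 g c s u) (leH _ _ sa su ub).
have V_ge c t : 0 < c -> time_seqs a b t ->
    sum_increments (excess g c) t <= fine (F c).
  by move=> c0 tab; rewrite -lee_fin fineK ?F_fin// S_le.
have V_le c M : 0 < c -> (forall t, time_seqs a b t ->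
    sum_increments (excess g c) t <= M) -> fine (F c) <= M.
  by move=> c0 leM; rewrite -lee_fin fineK ?F_fin// F_le.
have V_ge0 c : 0 < c -> 0 <= fine (F c) by move=> _; exact: fine_ge0.
have V_ni c d : 0 < c -> c <= d -> fine (F d) <= fine (F c).
  move=> c0 cd; apply: V_le => [|t tab]; first exact: lt_le_trans cd.
  apply: le_trans (V_ge _ _ c0 tab).
  by apply: ler_sum => i _; exact: le_excess.
have V_conv c d l : 0 < c -> 0 < d -> 0 <= l <= 1 ->
    fine (F (l * c + (1 - l) * d)) <= l * fine (F c) + (1 - l) * fine (F d).
  move=> c0 d0 l01; have /andP[l0 l1] := l01.
  apply: V_le => [|t tab].
    by case: (ltP 0 l) => l_0; [apply: ltr_pwDl|]; nra.
  apply: (@le_trans _ _ (l * sum_increments (excess g c) t +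
                        (1 - l) * sum_increments (excess g d) t)).
    rewrite /sum_increments !mulr_sumr -big_split/=.
    by apply: ler_sum => i _; exact: excess_convex.
  by rewrite lerD// ler_wpM2l ?subr_ge0// V_ge.
split.
- by move=> c c0; split; [exact: F_fin|].
- by move=> c d; rewrite !in_itv/= !andbT => c0 _; exact: V_ni.
- exact: convex_nonincr_continuous.
- move=> l c d; rewrite !inE/= !in_itv/= !andbT => c0 d0.
  by apply: V_conv; rewrite ?ge0 ?le1.
Qed.

End excess_sup.
(** * Controlling the large increments of a càdlàg function *)

Section cadlag_control.
Context {R : realType} (f : R -> R) (c : R).

(** An additive majorant of the excesses; unlike a common bound on all sums, it
    extends easily from an interval to a longer one. *)
Definition controlled (x y : R) := exists H : R -> R, forall s u,
  x <= s -> s < u -> u <= y -> excess (fun s u => `|f u - f s|) c s u <= H u - H s.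

(** Increments inside the open interval from [y] to [z] have no excess, so [H]
    only has to jump when [y] and when [z] is passed.  Through the midpoint [w],
    both jumps can be chosen of the same size [K]. *)
Lemma controlled_extend x y z : 0 < c -> x <= y -> y < z -> controlled x y ->
  (forall s u, y < s < z -> y < u < z -> `|f u - f s| <= c) -> controlled x z.
Proof.
move=> c0 xy yz [H HP] osc_c; pose w := (y + z) / 2.
have w_yz : y < w < z by rewrite /w; lra.
(* K covers the increments from y to w and from w to z, and the c lost when
   w is replaced by another point of the open interval. *)
pose K : R := `|f w - f y| + `|f z - f w| + c.
exists (fun u => if u <= y then H u else if u < z then H y + K else H y + K + K).
have H_le s : x <= s -> s <= y -> `|f y - f s| - c <= H y - H s /\ H s <= H y.
  move=> xs; rewrite le_eqVlt => /predU1P[->|sy].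
    by rewrite !subrr normr0 sub0r oppr_le0 ltW.
  have := HP _ _ xs sy (lexx y); rewrite ge_max subr_ge0 => /andP[? ->]//.
have wy0 := normr_ge0 (f w - f y); have zw0 := normr_ge0 (f z - f w).
move=> s u xs su uz; rewrite /excess/=.
have [uy|yu] := leP u y.
  by rewrite (le_trans (ltW su) uy) HP.
have [sy|ys] := leP s y.
  have [Hsy1 Hsy2] := H_le s xs sy.
  have tri v : `|f v - f s| <= `|f v - f w| + `|f w - f y| + `|f y - f s|.
    apply: le_trans (ler_distD (f y) _ _) _; rewrite lerD2r.
    exact: ler_distD.
  have := tri u; have [u_z|z_u] := ltP u z.
    have := osc_c w u w_yz; rewrite yu u_z => /(_ isT) fuw fus.
    by rewrite ge_max /K; apply/andP; split; lra.
  have -> : u = z by apply/eqP; rewrite eq_le uz z_u.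
  by move=> ?; rewrite ge_max /K; apply/andP; split; lra.
have sz : s < z by exact: lt_le_trans uz.
rewrite sz; have [u_z|z_u] := ltP u z.
  have := osc_c s u; rewrite ys sz yu u_z => /(_ isT isT) ?.
  by rewrite ge_max subrr lexx andbT subr_le0.
have -> : u = z by apply/eqP; rewrite eq_le uz z_u.
have := ler_distD (f w) (f z) (f s).
have := osc_c s w; rewrite ys sz w_yz => /(_ isT isT) ? ?.
by rewrite ge_max /K; apply/andP; split; lra.
Qed.

Lemma dist_near (l x y : R) : `|l - x| <= c / 2 -> `|l - y| <= c / 2 -> `|y - x| <= c.
Proof. by move=> lx ly; have := ler_distD l y x; rewrite (distrC y l); lra. Qed.

(** Let [m] be the supremum of the [y] up to which [f] is controlled.  The left
    limit at [m] carries the control from some [y] close to [m] up to [m] itself,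
    and right continuity carries it strictly beyond [m], unless [m = b]. *)
Lemma cadlag_controlled a b : 0 < c -> a < b -> cadlag a b f -> controlled a b.
Proof.
move=> c0 ab [f_right f_left].
have c2 : 0 < c / 2 by rewrite divr_gt0.
pose S := [set y | a <= y <= b /\ controlled a y].
have Sa : S a.
  split; first by rewrite lexx ltW.
  by exists (fun=> 0) => s u ? ? ?; exfalso; lra.
have supS : has_sup S by split; [exists a | exists b => y [/andP[]]].
set m := sup S.
have S_le y : S y -> y <= m by move=> Sy; apply: ub_le_sup => //; case: supS.
have am : a <= m by exact: S_le.
have mb : m <= b by apply: ge_sup; [exists a|move=> y [/andP[]]].
have Cm : controlled a m.
  move: am; rewrite le_eqVlt => /predU1P[<-|am]; first by case: Sa.
  have := f_left m; rewrite am mb => /(_ isT)[l].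
  move=> /cvgrPdist_le /(_ _ c2)[e /= e0 fe].
  have [y Sy] := sup_adherent e0 supS; rewrite -/m => my.
  have := S_le _ Sy.
  have [/andP[ay _] Cy] := Sy; rewrite le_eqVlt => /predU1P[<-//|ym].
  apply: (controlled_extend _ _ _ c0 _ _ Cy) => // s u /andP[ys sm] /andP[yu um].
  by apply: (dist_near l); apply: fe => //=; rewrite gtr0_norm; lra.
case: (ltP m b) => [{}mb|bm]; last first.
  by have <- : m = b by apply/eqP; rewrite eq_le mb bm.
have := f_right m; rewrite am mb => /(_ isT).
move=> /cvgrPdist_le /(_ _ c2)[e /= e0 fe].
pose z := Num.min (m + e) b.
have mz : m < z by rewrite lt_min mb andbT; lra.
have zm : z <= m + e by rewrite ge_min lexx.
have Sz : S z.
  split; first by rewrite (le_trans am (ltW mz))/= ge_min lexx orbT.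
  apply: (controlled_extend _ _ _ c0 _ _ Cm) => // s u /andP[ms sz] /andP[mu uz].
  by apply: (dist_near (f m)); apply: fe => //=; rewrite ltr0_norm; lra.
by have := lt_le_trans mz (S_le _ Sz); rewrite ltxx.
Qed.

End cadlag_control.

(** * Small and large values of the parameter *)

Section parameter_extremes.
Context {R : realType} (a b : R) (f : R -> R).

Lemma TVc_cvg : TVc a b f c @[c --> 0^'+] --> TV a b f.
Proof.
suff <- : ereal_sup (TVc a b f @` [set` `]0, +oo[]) = TV a b f.
  apply: nonincreasing_at_right_cvge => // c d _ _ cd.
  apply: ge_ereal_sup => _ [t tab <-]; apply: le_ereal_sup_tmp.
  exists (sum_increments (excess (fun s u => `|f u - f s|) c) t)%:E.
    by exists t.
  by rewrite lee_fin; apply: ler_sum => i _; exact: le_excess.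
apply/eqP; rewrite eq_le; apply/andP; split.
  apply: ge_ereal_sup => _ [c + <-]; rewrite /= in_itv/= andbT => c0.
  apply: ge_ereal_sup => _ [t tab <-]; apply: le_ereal_sup_tmp.
  exists (sum_increments (fun s u => `|f u - f s|) t)%:E; first by exists t.
  rewrite lee_fin; apply: ler_sum => i _.
  by rewrite ge_max normr_ge0 andbT gerBl ltW.
apply: ge_ereal_sup => _ [t tab <-]; apply/lee_addgt0Pr => e e0.
(* Each of the size t - 1 terms loses at most c, less than e in all. *)
pose c := e / (size t)%:R.
have [t_size _ _] := tab.
have c0 : 0 < c by rewrite divr_gt0// ltr0n ltnW.
apply: (@le_trans _ _ (TVc a b f c + e%:E)%E); last first.
  by rewrite leeD2r// ereal_sup_ubound//; exists c => //=; rewrite in_itv/= c0.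
apply: (@le_trans _ _
  (sum_increments (excess (fun s u => `|f u - f s|) c) t + e)%:E); last first.
  by rewrite EFinD leeD2r// ereal_sup_ubound//; exists t.
rewrite lee_fin -lerBlDr.
have -> : e = c *+ size t.
  by rewrite -mulr_natr divfK// pnatr_eq0 -lt0n ltnW.
have -> : c *+ size t = c + \sum_(1 <= i < size t) c.
  by rewrite big_const_nat iter_addr_0 -mulrS subn1 prednK// ltnW.
suff : sum_increments (fun s u => `|f u - f s|) t - \sum_(1 <= i < size t) c
       <= sum_increments (excess (fun s u => `|f u - f s|) c) t.
  by rewrite /sum_increments; lra.
rewrite /sum_increments -sumrB.
by apply: ler_sum => i _; rewrite /excess le_max lexx.
Qed.

Lemma TVc_osc c : a < b -> (osc a b f <= c%:E)%E -> TVc a b f c = 0%E.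
Proof.
move=> ab osc_c.
have excess0 s u : a <= s -> s < u -> u <= b ->
    excess (fun s u => `|f u - f s|) c s u = 0.
  move=> sa su ub; apply/max_idPr; rewrite subr_le0 -lee_fin.
  apply: le_trans osc_c; apply: ereal_sup_ubound.
  by exists u => /=; [|exists s] => //=; rewrite in_itv/=; lra.
have sum0 t : time_seqs a b t ->
    sum_increments (excess (fun s u => `|f u - f s|) c) t = 0.
  move=> tab; rewrite /sum_increments big_nat big1// => i it.
  by have [? ? ?] := time_seqs_step i tab it; exact: excess0.
apply/eqP; rewrite eq_le; apply/andP; split.
  by apply: ge_ereal_sup => _ [t /sum0 t0 <-]; rewrite lee_fin -[leRHS]t0.
apply: ereal_sup_ubound; exists [:: a; b]; first exact: time_seqs_nonempty.
by congr EFin; apply: sum0; exact: time_seqs_nonempty.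
Qed.

End parameter_extremes.

Theorem fact2p4 (R : realType) (a b : R) (f : R -> R) :
  a < b -> cadlag a b f ->
  [/\ nonincr_cont_convex (UTVc a b f),
      nonincr_cont_convex (DTVc a b f),
      nonincr_cont_convex (TVc a b f),
      TVc a b f c @[c --> 0^'+] --> TV a b f &
      forall c, 0 < c -> (osc a b f <= c%:E)%E -> TVc a b f c = 0%E].
Proof.
move=> ab f_cadlag.
have nice g : (forall s u, g s u <= `|f u - f s|) ->
    nonincr_cont_convex (fun c => sup_increments a b (excess g c)).
  move=> g_le; apply: nonincr_cont_convex_excess_sup => // c c0.
  have [H HP] := cadlag_controlled f c a b c0 ab f_cadlag.
  exists H => s u sa su ub; apply: le_trans (HP s u sa su ub).
  by rewrite /excess ge_max !le_max lexx orbT andbT lerB.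
split.
- by apply: (nice (fun s u => f u - f s)) => s u; exact: ler_norm.
- by apply: (nice (fun s u => f s - f u)) => s u; rewrite distrC ler_norm.
- exact: (nice (fun s u => `|f u - f s|)).
- exact: TVc_cvg.
- by move=> c _; exact: TVc_osc.
Qed.
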